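(* Consider an $m$-strategy CRS game ($m\ge 2$) on a star. For each $a\in A$ let $s_a$ be the number of stubborn leaves with fixed strategy $a$, and let $c_L$ and $r_L$ be the numbers of conformist leaves and rebel leaves. The game admits a pure strategy Nash equilibrium (PNE) if and only if one of the following conditions holds: (i) the central player is a conformist and there exists $a\in A$ such that $r_L\le\sum_{b\in A,\,b\ne a}\max\{0,c_L+s_a-s_b\}$; (ii) the central player is a rebel and there exists $a\in A$ such that $r_L\ge\sum_{b\in A,\,b\ne a}\max\{0,c_L+s_a-s_b\}$; (iii) the central player is stubborn.
   Context: An $m$-strategy CRS game consists of a finite set of players $N=C\cup R\cup S$ (disjoint union of conformists $C$, rebels $R$ and stubborn agents $S$), a set $E\neq\emptyset$ of undirected edges on $N$ without loops, and a strategy set $A=\{a_1,\dots,a_m\}$ common to all players. $N_i=\{j: ij\in E\}$ is the set of neighbors of $i$. The game is on a star if there is a player $i$ (the central player) with $E=\{ij: j\in N, j\ne i\}$; the other players are the leaves. Each stubborn agent has a predetermined fixed strategy in $A$ which it never changes, so strategy profiles $\boldsymbol x\in A^N$ always have $x_i$ equal to the fixed strategy for $i\in S$. Payoffs are $u_i(\boldsymbol x)=|\{j\in N_i: x_j=x_i\}|$ for $i\in C$, $u_i(\boldsymbol x)=|\{j\in N_i: x_j\ne x_i\}|$ for $i\in R$, and $u_i(\boldsymbol x)=0$ for $i\in S$. A profile $\boldsymbol x^*$ is a PNE if no conformist or rebel $i$ can strictly increase $u_i$ by unilaterally changing its strategy: $u_i(\boldsymbol x^* )\ge u_i(x_i,\boldsymbol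 x^*_{-i})$ for all $x_i\in A$. *)

(* Defs.v *)
From HB Require Import structures.
From mathcomp Require Import all_boot all_order all_algebra.
Set Implicit Arguments. Unset Strict Implicit. Unset Printing Implicit Defensive.
Import Order.TTheory GRing.Theory Num.Theory.

(* A stubborn agent carries its predetermined strategy, so a map from players
   to roles gives both the disjoint union N = C + R + S and the fixed
   strategies of the agents in S. *)
Variant role (A : Type) : Type :=
  | Conformist
  | Rebel
  | Stubborn of A.
Arguments Conformist {A}.
Arguments Rebel {A}.

Definition is_conformist (A : Type) (r : role A) : bool :=
  if r is Conformist then true else false.
Definition is_rebel (A : Type) (r : role A) : bool :=
  if r is Rebel then true else false.
Definition is_stubborn (A : Type) (r : role A) : bool :=
  if r is Stubborn _ then true else false.
Definition is_stubborn_on (A : eqType) (a : A) (r : role A) : bool :=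
  if r is Stubborn b then b == a else false.

(* An undirected edge ij is the two-element set {i, j}; the cardinality
   condition excludes loops. *)
Record crs_game (A : finType) : Type := CRSGame {
  player : finType;
  player_role : player -> role A;
  edges : {set {set player}};
  edges_loopless : forall e : {set player}, e \in edges -> #|e| = 2;
  edges_nonempty : edges != set0
}.

Section Game.
Variables (A : finType) (G : crs_game A).
Local Notation N := (player G).

Definition conformists : {set N} := [set i | is_conformist (player_role i)].
Definition rebels : {set N} := [set i | is_rebel (player_role i)].
Definition stubborns : {set N} := [set i | is_stubborn (player_role i)].

Definition neighbors (i : N) : {set N} := [set j | [set i; j] \in edges G].

Definition is_profile (x : {ffun N -> A}) : Prop :=
  forall (i : N) (a : A), player_role i = Stubborn a -> x i = a.

Definition payoff (x : {ffun N -> A}) (i : N) : nat :=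
  match player_role i with
  | Conformist => #|[set j in neighbors i | x j == x i]|
  | Rebel => #|[set j in neighbors i | x j != x i]|
  | Stubborn _ => 0
  end.

Definition deviate (x : {ffun N -> A}) (i : N) (a : A) : {ffun N -> A} :=
  [ffun j => if j == i then a else x j].

Definition is_PNE (x : {ffun N -> A}) : Prop :=
  is_profile x /\
  forall i : N, i \in conformists :|: rebels ->
  forall a : A, payoff (deviate x i a) i <= payoff x i.

Definition admits_PNE : Prop := exists x : {ffun N -> A}, is_PNE x.

Definition is_star_center (i : N) : Prop :=
  edges G = [set [set i; j] | j in [set j : N | j != i]].

Definition conformist_leaves (i : N) : nat :=
  #|[set j in conformists | j != i]|.
Definition rebel_leaves (i : N) : nat :=
  #|[set j in rebels | j != i]|.
Definition stubborn_leaves (i : N) (a : A) : nat :=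
  #|[set j : N | (j != i) && is_stubborn_on a (player_role j)]|.

End Game.

(* Main.v *)
(** In an equilibrium on a star every conformist leaf copies the centre's
    strategy [a] and every rebel leaf avoids it, so [a] is played by
    [c_L + s_a] leaves and each [b <> a] by [s_b + r_b] leaves, where the [r_b]
    sum to [r_L].  A rebel centre is content iff [c_L + s_a <= s_b + r_b] for
    all [b <> a]; since [r_b >= 0] this says [r_b >= max(0, c_L + s_a - s_b)],
    and any surplus of rebels can be put on one fixed [b].  A conformist centre
    needs [r_b <= c_L + s_a - s_b], where the right-hand side may be negative;
    but the sum of the positive parts is nondecreasing in [s_a], so [a] may be
    taken to maximise [s_a], and then no term is negative. *)
Require Import Defs.
From HB Require Import structures.
From mathcomp Require Import all_boot all_order all_algebra.
Set Implicit Arguments. Unset Strict Implicit. Unset Printing Implicit Defensive.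
From mathcomp Require Import zify.
Import Order.TTheory GRing.Theory Num.Theory.

(** * Lists of strategies with prescribed multiplicities *)

Lemma exists_fun_count (T : finType) (A : eqType) (R : {set T}) (s : seq A)
    (a0 : A) :
  size s = #|R| ->
  exists g : T -> A, (forall j, j \in R -> g j \in s) /\
    forall b, #|[set j in R | g j == b]| = count_mem b s.
Proof.
(* The k-th element of [R] takes the k-th entry of [s]; [a0] serves only as the default of [nth]. *)
move=> sz; pose g j := nth a0 s (index j (enum R)).
have szE : size (enum R) = size s by rewrite -cardE sz.
exists g; split=> [j jR|b].
  by rewrite mem_nth // -szE index_mem mem_enum.
have <- : map g (enum R) = s.
  apply: (@eq_from_nth _ a0); rewrite size_map // => k kR.
  have [t0 _] : exists t : T, t \in enum R.
    by case: (enum R) kR => // t r _; exists t; rewrite mem_head.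
  by rewrite (nth_map t0) // /g index_uniq // enum_uniq.
rewrite count_map cardE -size_filter /enum_mem -filter_predI.
by congr (size _); apply: eq_filter => j /=; rewrite !inE andbC.
Qed.

Section SeqOfCounts.
Variables (A : finType) (a : A) (f : A -> nat).

(** A multiset avoiding [a], kept as a list so that truncating or padding fits its size to the
    number of rebel leaves. *)
Definition seq_of_counts : seq A :=
  flatten [seq nseq (f b) b | b <- enum (predC1 a)].

Lemma size_seq_of_counts : size seq_of_counts = \sum_(b | b != a) f b.
Proof.
rewrite size_flatten sumnE /shape -map_comp big_map big_enum /=.
by apply: eq_bigr => b _; rewrite size_nseq.
Qed.

Lemma notin_seq_of_counts : a \notin seq_of_counts.
Proof.
apply/negP => /flattenP [u /mapP [b + ->]].
rewrite mem_enum inE => ba.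
by rewrite mem_nseq eq_sym (negbTE ba) andbF.
Qed.

Lemma count_seq_of_counts b : b != a -> count_mem b seq_of_counts = f b.
Proof.
move=> ba; rewrite count_flatten sumnE -map_comp big_map big_enum /=.
rewrite (bigD1 b) //= count_nseq /= eqxx mul1n big1 ?addn0 // => c /andP [_ cb].
by rewrite count_nseq /= (negbTE cb).
Qed.

Lemma exists_seq_count_le k : k <= \sum_(b | b != a) f b ->
  exists s : seq A, [/\ size s = k, a \notin s &
    forall b, b != a -> count_mem b s <= f b].
Proof.
rewrite -size_seq_of_counts => le_k; exists (take k seq_of_counts); split.
- by rewrite size_takel.
- by apply: contra notin_seq_of_counts; apply: mem_take.
move=> b ba; rewrite -(count_seq_of_counts ba).
by rewrite -{2}(cat_take_drop k seq_of_counts) count_cat leq_addr.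
Qed.

(** The surplus over the prescribed counts all goes to [b0]. *)
Lemma exists_seq_count_ge k (b0 : A) :
  b0 != a -> \sum_(b | b != a) f b <= k ->
  exists s : seq A, [/\ size s = k, a \notin s &
    forall b, b != a -> f b <= count_mem b s].
Proof.
rewrite -size_seq_of_counts => b0a le_k.
exists (seq_of_counts ++ nseq (k - size seq_of_counts) b0); split.
- by rewrite size_cat size_nseq subnKC.
- rewrite mem_cat negb_or notin_seq_of_counts mem_nseq negb_and.
  by rewrite (eq_sym a) b0a orbT.
by move=> b ba; rewrite count_cat count_seq_of_counts // leq_addr.
Qed.

End SeqOfCounts.

(** * Neighbourhoods, payoffs and equilibria on a star *)

Section Star.
Variables (A : finType) (G : crs_game A) (i : player G).
Hypothesis hi : is_star_center i.
Local Notation N := (player G).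
Local Notation c := (conformist_leaves i).
Local Notation s := (stubborn_leaves i).
Local Notation r := (rebel_leaves i).

Lemma neighbors_center : neighbors i = [set~ i].
Proof.
apply/setP => j; rewrite !inE hi; apply/imsetP/idP => [[k]|ji]; last first.
  by exists j; rewrite ?inE.
rewrite inE => ki /setP /(_ k); rewrite !inE eqxx orbT (negbTE ki) /=.
by move=> /eqP kj; rewrite -kj.
Qed.

Lemma neighbors_leaf (j : N) : j != i -> neighbors j = [set i].
Proof.
move=> ji; apply/setP => k; rewrite !inE hi.
apply/imsetP/eqP => [[l]|->]; last by exists j; rewrite ?inE // setUC.
(* The edge {j, k} equals some {i, l}, so it contains i, and i <> j forces k = i. *)
rewrite inE => li /setP e; have := e i; have := e j.
rewrite !inE !eqxx (negbTE ji) (eq_sym i j) (negbTE ji) /=.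
by move=> _ /eqP.
Qed.

Lemma neighbors_notin (j : N) : j \notin neighbors j.
Proof.
rewrite inE setUid; apply/negP => /edges_loopless.
by rewrite cards1.
Qed.

Definition load (x : {ffun N -> A}) (b : A) : nat :=
  #|[set j | (j != i) && (x j == b)]|.

(** Best replies of the leaves, whose only neighbour is the centre; the stubborn case carries the
    profile condition. *)
Definition leaves_best (x : {ffun N -> A}) : Prop :=
  forall j, j != i -> match player_role j with
    | Conformist => x j = x i
    | Rebel => x j != x i
    | Stubborn a => x j = a
    end.

(** Without loops, a deviation of [j] leaves the strategies of its neighbours untouched. *)
Lemma payoff_deviate (x : {ffun N -> A}) (j : N) (b : A) :
  payoff (deviate x j b) j = match player_role j with
    | Conformist => #|[set k in neighbors j | x k == b]|
    | Rebel => #|[set k in neighbors j | x k != b]|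
    | Stubborn _ => 0
    end.
Proof.
rewrite /payoff; case: (player_role j) => // ; apply: eq_card => k.
all: rewrite !in_set !ffunE eqxx; case: (altP (k =P j)) => // ->.
all: by move: (neighbors_notin j); rewrite in_set => /negbTE ->.
Qed.

Lemma deviate_id (x : {ffun N -> A}) (j : N) : deviate x j (x j) = x.
Proof. by apply/ffunP => k; rewrite ffunE; case: eqP => [->|]. Qed.

Lemma card_singleton_pred (P : pred N) :
  #|[set k in [set i] | P k]| = P i.
Proof.
case Pi: (P i).
  transitivity #|[set i]|; last by rewrite cards1.
  apply: eq_card => k; rewrite !inE.
  by case: eqP => // ->.
apply: eq_card0 => k; rewrite !inE.
by case: eqP => // ->.
Qed.

Lemma card_center_eq (x : {ffun N -> A}) (b : A) :
  #|[set k in neighbors i | x k == b]| = load x b.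
Proof. by apply: eq_card => k; rewrite neighbors_center !inE. Qed.

(** The total does not depend on [b], so a rebel centre maximises its payoff by minimising the load
    it matches. *)
Lemma card_center_neq (x : {ffun N -> A}) (b : A) :
  #|[set k in neighbors i | x k != b]| + load x b = #|[set~ i]|.
Proof.
rewrite -card_center_eq addnC -(cardsID [set k | x k == b] [set~ i]).
by congr (_ + _); apply: eq_card => k; rewrite neighbors_center !inE // andbC.
Qed.

Lemma is_PNE_star (hA : 2 <= #|A|) (x : {ffun N -> A}) :
  is_PNE x <->
  [/\ leaves_best x,
      forall b, player_role i = Stubborn b -> x i = b,
      i \in conformists G -> forall b, load x b <= load x (x i) &
      i \in rebels G -> forall b, load x (x i) <= load x b].
Proof.
split=> [[prof br]|[lb xs xc xr]].
  have br' j b : j \in conformists G :|: rebels G ->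
      payoff (deviate x j b) j <= payoff (deviate x j (x j)) j.
    by move=> jcr; rewrite deviate_id; apply: br.
  split=> [j ji||ic b|ir b].
  - have := br' j; case Ej: (player_role j) (prof j) => [||d] pj brj.
    + have := brj (x i); rewrite !inE Ej => /(_ isT).
      rewrite !payoff_deviate Ej neighbors_leaf // !card_singleton_pred eqxx.
      by case: eqP.
    (* A rebel leaf matching the centre would gain by moving to any other strategy, and one exists
       by [hA]. *)
    + have [b bi] : exists b, b != x i.
        have [b] : exists b, b \in [set~ x i].
          by apply/set0Pn; rewrite -card_gt0 cardsC1; lia.
        by rewrite !inE; exists b.
      have := brj b; rewrite !inE Ej => /(_ isT).
      rewrite !payoff_deviate Ej neighbors_leaf // !card_singleton_pred.
      by rewrite eq_sym bi (eq_sym (x j)); case: (x i != x j).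
    + exact: pj.
  - exact: prof.
  - have := br' i b; rewrite !inE !payoff_deviate; move: ic; rewrite inE.
    by case: (player_role i) => // _ /(_ isT); rewrite !card_center_eq.
  - have := br' i b; rewrite !inE !payoff_deviate; move: ir; rewrite inE.
    case: (player_role i) => // _ /(_ isT).
    have := card_center_neq x b; have := card_center_neq x (x i); lia.
split=> [j b Ej|j jcr b].
  have [ji|ji] := eqVneq j i; first by rewrite ji in Ej *; exact: xs.
  by have := lb j ji; rewrite Ej.
(* The current profile is read as a trivial deviation, so that one formula covers both payoffs. *)
rewrite -{2}(deviate_id x j) !payoff_deviate.
have [ji|ji] := eqVneq j i.
  rewrite {j}ji in jcr *; move: jcr xc xr; rewrite !inE.
  case: (player_role i) => //= _ xc xr.
    by rewrite !card_center_eq xc.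
  have := card_center_neq x b; have := card_center_neq x (x i).
  by have := xr isT b; lia.
have := lb j ji; case: (player_role j) => // xj.
all: rewrite neighbors_leaf // !card_singleton_pred.
  by rewrite xj eqxx; case: eqP.
by rewrite (eq_sym (x i) (x j)) xj; case: eqP.
Qed.

(** * Loads in terms of the numbers of leaves of each role *)

Definition rebel_load (x : {ffun N -> A}) (b : A) : nat :=
  #|[set j in [set j in rebels G | j != i] | x j == b]|.

(** All conformist leaves are counted; the rest are stubborn, since rebel leaves avoid [x i]. *)
Lemma load_center (x : {ffun N -> A}) :
  leaves_best x -> load x (x i) = c + s (x i).
Proof.
move=> lb; rewrite /load -(cardsID (conformists G)).
congr (_ + _); apply: eq_card => j; rewrite !inE.
all: case: (altP (j =P i)) => [->|ji]; rewrite /= ?andbF //.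
all: have := lb j ji; case: (player_role j) => [||b] /= xj.
all: by rewrite ?andbT ?andbF // ?xj ?eqxx // (negbTE xj).
Qed.

Lemma load_noncenter (x : {ffun N -> A}) (b : A) :
  leaves_best x -> b != x i -> load x b = rebel_load x b + s b.
Proof.
move=> lb bi; rewrite /load -(cardsID (rebels G)).
congr (_ + _); apply: eq_card => j; rewrite !inE.
all: case: (altP (j =P i)) => [->|ji]; rewrite /= ?andbF //.
all: have := lb j ji; case: (player_role j) => [||d] /= xj.
all: by rewrite ?andbT ?andbF ?xj // eq_sym (negbTE bi).
Qed.

(** Rebel leaves are partitioned by strategy, and none plays [x i]. *)
Lemma sum_rebel_load (x : {ffun N -> A}) :
  leaves_best x -> \sum_(b | b != x i) rebel_load x b = r.
Proof.
move=> lb; rewrite /rebel_leaves -sum1_card.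
rewrite (partition_big x (fun b => b != x i)) /=; last first.
  move=> j; rewrite !inE => /andP [jr ji].
  by have := lb j ji; case: (player_role j) jr.
by apply: eq_bigr => b _; rewrite /rebel_load -sum1_card; apply: eq_bigl => j; rewrite !inE.
Qed.

(** Conformist leaves copy [a], and the entries of [t] are handed out to the rebel leaves. *)
Lemma exists_leaves_best (a : A) (t : seq A) :
  (forall b, player_role i = Stubborn b -> b = a) ->
  size t = r -> a \notin t ->
  exists x : {ffun N -> A}, [/\ x i = a, leaves_best x &
    forall b, rebel_load x b = count_mem b t].
Proof.
move=> ia szt at_; have [g [gt gc]] := exists_fun_count a szt.
pose x : {ffun N -> A} := [ffun j => if j == i then a else
  match player_role j with
  | Conformist => a | Rebel => g j | Stubborn b => b end].
have xi : x i = a by rewrite ffunE eqxx.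
exists x; split=> [//|j ji|b].
  rewrite xi ffunE (negbTE ji); case Ej: (player_role j) => //.
  have gj : g j \in t by apply: gt; rewrite !inE Ej.
  by apply: contraNneq at_ => <-.
rewrite -gc; apply: eq_card => j; rewrite !inE ffunE.
by case: eqP => //=; rewrite ?andbF //; case: (player_role j).
Qed.

(** Truncated subtraction of naturals makes this max(0, c_L + s_a - s_b). *)
Definition demand (a b : A) : nat := c + s a - s b.

Lemma sum_demandE (a : A) :
  (\sum_(b : A | b != a) Num.max 0 (c%:Z + (s a)%:Z - (s b)%:Z) =
   (\sum_(b | b != a) demand a b)%:Z)%R.
Proof.
rewrite (big_morph Posz PoszD (erefl (Posz 0))); apply: eq_bigr => b _.
rewrite /demand; lia.
Qed.

(* Adding the diagonal term [demand a a = c], which does not depend on [a],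
   makes the sum visibly monotone in [s a]. *)
Lemma sum_demand_mono (a a' : A) : s a <= s a' ->
  \sum_(b | b != a) demand a b <= \sum_(b | b != a') demand a' b.
Proof.
move=> saa'; rewrite -(leq_add2l c).
have E d : c + \sum_(b | b != d) demand d b = \sum_b demand d b.
  by rewrite [RHS](bigD1 d) //= {2}/demand addnK.
by rewrite !E; apply: leq_sum => b _; rewrite /demand; lia.
Qed.

End Star.

(** * Existence of an equilibrium, by the role of the centre *)

Theorem corollary2 (m : nat) (A : finType) (hA : #|A| = m) (hm : 2 <= m)
    (G : crs_game A) (i : player G) (hi : is_star_center i) :
  admits_PNE G <->
  [\/ i \in conformists G /\
        exists a : A,
          ((rebel_leaves i)%:Z <=
           \sum_(b : A | b != a)
             Num.max 0 ((conformist_leaves i)%:Z + (stubborn_leaves i a)%:Z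
                        - (stubborn_leaves i b)%:Z))%R,
      i \in rebels G /\
        exists a : A,
          ((rebel_leaves i)%:Z >=
           \sum_(b : A | b != a)
             Num.max 0 ((conformist_leaves i)%:Z + (stubborn_leaves i a)%:Z
                        - (stubborn_leaves i b)%:Z))%R
    | i \in stubborns G].
Proof.
rewrite -{}hA in hm.
have other (a : A) : exists b, b != a.
  have [b] : exists b, b \in [set~ a].
    by apply/set0Pn; rewrite -card_gt0 cardsC1; lia.
  by rewrite !inE; exists b.
split=> [[x /(is_PNE_star hi hm) [lb xs xc xr]]|].
  case Ei: (player_role i) => [||d]; last by apply: Or33; rewrite inE Ei.
  - have ic : i \in conformists G by rewrite inE Ei.
    apply: Or31; split=> //; exists (x i); rewrite sum_demandE lez_nat.
    (* Contentment of the centre gives r_b + s_b <= c_L + s_a, hence the bound on r_b term by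
       term. *)
    rewrite -(sum_rebel_load lb); apply: leq_sum => b bi.
    have := xc ic b; rewrite load_center // load_noncenter // /demand; lia.
  - have ir : i \in rebels G by rewrite inE Ei.
    apply: Or32; split=> //; exists (x i); rewrite sum_demandE lez_nat.
    (* The inequality is now reversed, and r_b >= 0 covers the truncated terms. *)
    rewrite -(sum_rebel_load lb); apply: leq_sum => b bi.
    have := xr ir b; rewrite load_center // load_noncenter // /demand; lia.
case=> [[ic [a]]|[ir [a]]|].
- rewrite sum_demandE lez_nat => ra.
  (* Passing to a maximiser of s_a keeps the bound and makes every subtraction in [demand] exact. *)
  have [a' _ amax] := arg_maxnP (stubborn_leaves i) (erefl true : xpredT a).
  have ra' := leq_trans ra (sum_demand_mono (amax a isT)).
  have [t [szt at_ tle]] := exists_seq_count_le ra'.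
  have [|x [xi lb xt]] := exists_leaves_best _ szt at_.
    by move=> b Ei; move: ic; rewrite inE Ei.
  exists x; apply/(is_PNE_star hi hm); split=> // [b Ei|_ b|].
  + by move: ic; rewrite inE Ei.
  + have [->//|bi] := eqVneq b (x i).
    rewrite load_center // load_noncenter // xt.
    rewrite xi in bi *; have := tle b bi; have := amax b isT.
    by rewrite /demand; lia.
  + by move: ic; rewrite !inE; case: (player_role i).
- rewrite sum_demandE lez_nat => ra; have [b0 b0a] := other a.
  have [t [szt at_ tge]] := exists_seq_count_ge b0a ra.
  have [|x [xi lb xt]] := exists_leaves_best _ szt at_.
    by move=> b Ei; move: ir; rewrite inE Ei.
  exists x; apply/(is_PNE_star hi hm); split=> // [b Ei||_ b].
  + by move: ir; rewrite inE Ei.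
  + by move: ir; rewrite !inE; case: (player_role i).
  + have [->//|bi] := eqVneq b (x i).
    rewrite load_center // load_noncenter // xt.
    rewrite xi in bi *; have := tge b bi.
    by rewrite /demand; lia.
rewrite inE; case Ei: (player_role i) => [||a] // _.
have [b0 b0a] := other a.
(* A stubborn centre ignores the loads, so all rebel leaves may play the same [b0]. *)
have [|||x [xi lb _]] := @exists_leaves_best _ _ i a (nseq (rebel_leaves i) b0).
- by move=> b; rewrite Ei => -[].
- by rewrite size_nseq.
- by rewrite mem_nseq negb_and (eq_sym a) b0a orbT.
exists x; apply/(is_PNE_star hi hm); split=> // [b||].
- by rewrite Ei => -[<-].
- by rewrite inE Ei.
- by rewrite inE Ei.
Qed.
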